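(* Let $w\in S^{k,n}$ and let $\lambda(w)$ be the corresponding partition. Then, taking the Newton interpolation coefficient with respect to the last variable $x_k$, $$\big[(x_1-x_k)\cdots(x_{k-1}-x_k)\,s_{\lambda(w)}(x_1,\ldots,x_k|y)\big]_{i-1}=(-1)^{\#(w,\psi_i.w)}\,s_{\lambda(\psi_i.w)}(x_1,\ldots,x_{k-1}|y),$$ or alternatively, in terms of the Demazure operators $\partial_j=\frac{1-s_j}{y_j-y_{j+1}}$, $$\partial_{i-1}\cdots\partial_1\big[(x_1-y_1)\cdots(x_{k-1}-y_1)\,s_{\lambda(w)}(x_1,\ldots,x_{k-1},y_1|y)\big]=(-1)^{\#(w,\psi_i.w)}\,s_{\lambda(\psi_i.w)}(x_1,\ldots,x_{k-1}|y).$$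
   Context: Fix $n\ge2$, $1\le k\le n$ and $1\le i\le n$; $y_1,\ldots,y_n$ are the equivariant parameters. $S^{k,n}\subset S_n$ is the set of Grassmannian permutations $w=[w_1\ldots w_n]$ with $w_1<\cdots<w_k$ and $w_{k+1}<\cdots<w_n$; $\lambda(w)=(\lambda_1,\ldots,\lambda_k)$ is the partition with $w_j=\lambda_{k+1-j}+j$, whose Young diagram fits into the $k\times(n-k)$ rectangle. $(x|y)^m=\prod_{j=1}^m(x-y_j)$, and $s_\lambda(x_1,\ldots,x_k|y)=\det\big((x_j|y)^{\lambda_i+k-i}\big)_{1\le i,j\le k}/\prod_{i<j}(x_i-x_j)$ is the factorial Schur polynomial, which represents an equivariant Schubert class of the Grassmannian $\mathrm{Gr}(k;n)$. Newton coefficients: a polynomial $p(x)$ of degree at most $n$ is written $p(x)=\sum_{r=0}^n[p]_r\,(x|y)^r$ with $[p]_r=\sum_{a=1}^{r+1}p(y_a)/\prod_{1\le j\le r+1,\,j\ne a}(y_a-y_j)$. In the Demazure operators, $s_j$ exchanges $y_j$ and $y_{j+1}$. $\psi_i.w\in S^{k-1,n}$ denotes the Grassmannian permutation obtained from $w$ by the following procedure: add a column of maximal height $k$ to the Young diagram of $\lambda(w)$, then remove a rim hook of length $i$; the result is the Young diagram of $\lambda(\psi_i.w)$. The number $\#(w,\psi_i.w)$ is the height (number of rows) of the removed rim hook minus one. If the outcome of this procedure is not a Young diagram, the image under $\psi_i$ is zero, i.e. the right-hand side is read as zero.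
   Formalization: In the Demazure form the operators act only on the y_1 substituted for x_k, the parameters in s_λ(·|y) being held constant; if s_j also moved the parameters, the formula would fail (n=2, k=1, w=[2 1], i=2 gives 0 = 1). *)

(* Defs.v *)
From HB Require Import structures.
From mathcomp Require Import all_boot all_order all_algebra.
From mathcomp Require Import fraction perm mpoly.

Set Implicit Arguments.
Unset Strict Implicit.
Unset Printing Implicit Defensive.

Import GRing.Theory.
Local Open Scope ring_scope.

(* All indices are 0-based: y_1, ..., y_n become y 0, ..., y n.-1, and a
   partition (la_1, ..., la_k) is the sequence with nth 0 la a = la_(a+1),
   trailing zeros allowed. *)

Section GrassmannianPermutations.

Variable n : nat.
Implicit Types (k : nat) (w : 'S_n.+1).

(* S^{k,n+1} *)
Definition grassmannian k w : bool :=
  [forall a : 'I_n.+1, forall b : 'I_n.+1,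
     (a < b)%N && ((b < k)%N || (k <= a)%N) ==> (w a < w b)%N].

(* w_j = la_(k+1-j) + j, i.e. la_(a+1) = w_(k-a) - (k-a); the truncated
   subtraction is exact for Grassmannian w. *)
Definition grass_shape k w : seq nat :=
  [seq (w (inord (k - a.+1)) - (k - a.+1))%N | a <- iota 0 k].

End GrassmannianPermutations.

Section RimHooks.

Variables m n : nat.
Local Notation cell := ('I_m * 'I_n)%type.
Implicit Types (la mu nu : seq nat) (H : {set cell}) (c d : cell).

Definition diagram la : {set cell} := [set c : cell | (c.2 < nth 0 la c.1)%N].

Definition adjacent c d : bool :=
     (c.1 == d.1) && ((c.2.+1 == d.2 :> nat) || (d.2.+1 == c.2 :> nat))
  || (c.2 == d.2) && ((c.1.+1 == d.1 :> nat) || (d.1.+1 == c.1 :> nat)).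

Definition connected_cells H : bool :=
  [forall c in H, forall d in H,
     connect [rel a b | [&& a \in H, b \in H & adjacent a b]] c d].

Definition has_2x2_square H : bool :=
  [exists a : 'I_m, exists a' : 'I_m, exists b : 'I_n, exists b' : 'I_n,
     [&& a' == a.+1 :> nat, b' == b.+1 :> nat, (a, b) \in H, (a, b') \in H,
         (a', b) \in H & (a', b') \in H]].

(* mu is obtained from nu by removing a rim hook with l boxes *)
Definition rim_hook_removal l nu mu : bool :=
  let H := diagram nu :\: diagram mu in
  [&& diagram mu \subset diagram nu, #|H| == l, connected_cells H
    & ~~ has_2x2_square H].

(* number of rows met by nu / mu, minus one *)
Definition leg_length nu mu : nat :=
  #|[set c.1 | c in diagram nu :\: diagram mu]|.-1.

End RimHooks.

Definition add_column (la : seq nat) : seq nat := [seq a.+1 | a <- la].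

(* w is in S^{k+1,n+1}; the image, in S^{k,n+1}, is None when the procedure
   does not produce a Young diagram. The diagram of the image has k rows, so the
   rim hook contains the whole of row k+1; hence at most one w' qualifies. The
   box of k+1 rows and n+1 columns contains every diagram involved. *)
Definition psi n k (i : nat) (w : 'S_n.+1) : option 'S_n.+1 :=
  [pick w' : 'S_n.+1 | grassmannian k w' &&
     rim_hook_removal k.+1 n.+1 i
       (add_column (grass_shape k.+1 w)) (grass_shape k w')].

Definition hook_height n k (w w' : 'S_n.+1) : nat :=
  leg_length k.+1 n.+1 (add_column (grass_shape k.+1 w)) (grass_shape k w').

Section FactorialPower.

Variables (B : comNzRingType) (n : nat) (y : 'I_n -> B).

(* (x|y)^m, for m <= n *)
Definition fact_power (x : B) (m : nat) : B := \prod_(j < n | (j < m)%N) (x - y j).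

End FactorialPower.

Lemma det_horner_dvd (B : comNzRingType) (k : nat) (f : 'I_k -> {poly B})
    (x : 'I_k -> B) :
  exists q : B, q * \prod_(a < k) \prod_(b < k | (a < b)%N) (x a - x b)
                = \det (\matrix_(a, b) (f a).[x b]).
Proof.
elim: k f x => [|k IHk] f x.
  by exists 1; rewrite big_ord0 mulr1 det_mx00.
have [g fE] : exists g : 'I_k.+1 -> {poly B},
    forall a, f a = (f a).[x ord0]%:P + g a * ((x ord0)%:P - 'X).
  apply: (fin_all_exists (P := fun a ga =>
    f a = (f a).[x ord0]%:P + ga * ((x ord0)%:P - 'X))) => a.
  have /factor_theorem[h hE] : root (f a - (f a).[x ord0]%:P) (x ord0).
    by rewrite /root !hornerE subrr.
  by exists (- h); rewrite mulNr -mulrN opprB -hE addrC subrK.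
pose G := \matrix_(a, b < k.+1)
  if b == ord0 then (f a).[x ord0] else (g a).[x b].
pose U : 'M[B]_k.+1 := \matrix_(a, b)
  if a == ord0 then 1 else (x ord0 - x b) *+ (a == b).
have -> : \matrix_(a, b) (f a).[x b] = G *m U.
  apply/matrixP => a b; rewrite !mxE big_ord_recl !mxE /= mulr1.
  case: (unliftP ord0 b) => [b'|] ->.
    rewrite (bigD1 b') //= big1 ?addr0 => [|c cb]; last first.
      by rewrite !mxE /= (inj_eq lift_inj) (negbTE cb) mulr0n mulr0.
    by rewrite !mxE /= eqxx mulr1n {1}fE !hornerE.
  rewrite big1 ?addr0 // => c _.
  by rewrite !mxE /= mulr0n mulr0.
have dU : \det U = \prod_(b < k) (x ord0 - x (lift ord0 b)).
  rewrite -det_tr det_trig; last first.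
    apply/is_trig_mxP => a b ab; rewrite !mxE -val_eqE /=.
    case: b ab => [[|b] ltb] //= ab.
    by rewrite -val_eqE /= gtn_eqF // mulr0n.
  rewrite big_ord_recl !mxE /= mul1r; apply: eq_bigr => b _.
  by rewrite !mxE /= eqxx.
have [q qE] : exists q : 'I_k.+1 -> B, forall a,
    q a * \prod_(c < k) \prod_(d < k | (c < d)%N)
            (x (lift ord0 c) - x (lift ord0 d)) = cofactor G a ord0.
  apply: (fin_all_exists (P := fun a qa =>
    qa * \prod_(c < k) \prod_(d < k | (c < d)%N)
            (x (lift ord0 c) - x (lift ord0 d)) = cofactor G a ord0)) => a.
  have [q qE] := IHk (fun c => g (lift a c)) (fun c => x (lift ord0 c)).
  exists ((-1) ^+ (a + 0) * q); rewrite -mulrA qE /cofactor; congr (_ * \det _).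
  by apply/matrixP => c d; rewrite !mxE.
exists (\sum_a (f a).[x ord0] * q a).
rewrite det_mulmx dU (expand_det_col _ ord0).
under [X in _ = X * _]eq_bigr => a _ do rewrite -qE mulrA {1}mxE eqxx.
rewrite -mulr_suml -mulrA; congr (_ * _).
rewrite big_ord_recl mulrC; congr (_ * _).
  apply: eq_bigr => c _.
  by rewrite [LHS]big_mkcond /= big_ord_recl /= mul1r -big_mkcond.
by rewrite big_mkcond big_ord_recl /= mul1r.
Qed.

Section FactorialSchur.

Variables (A : idomainType) (n : nat) (y : 'I_n -> A) (k : nat).
Local Notation yC := (fun j => (y j)%:MP_[k] : {mpoly A[k]}).

Definition fact_schur_num (la : seq nat) : {mpoly A[k]} :=
  \det (\matrix_(a < k, b < k) fact_power yC 'X_b (nth 0 la a + k - a.+1)%N).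

Definition vandermonde_prod : {mpoly A[k]} :=
  \prod_(a < k) \prod_(b < k | (a < b)%N) ('X_a - 'X_b).

Lemma fact_schur_subproof (la : seq nat) :
  exists q : {mpoly A[k]}, q * vandermonde_prod == fact_schur_num la.
Proof.
pose f (a : 'I_k) : {poly {mpoly A[k]}} :=
  \prod_(j < n | (j < nth 0 la a + k - a.+1)%N) ('X - (yC j)%:P).
have [q qE] := det_horner_dvd f (fun b => 'X_b).
exists q; apply/eqP; rewrite qE /fact_schur_num; congr (\det _).
apply/matrixP => a b; rewrite !mxE horner_prod.
by apply: eq_bigr => j _; rewrite !hornerE.
Qed.

(* s_la(x_1, ..., x_k | y): the quotient is exact, and unique since
   vandermonde_prod is a nonzero element of an integral domain. *)
Definition fact_schur (la : seq nat) : {mpoly A[k]} :=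
  xchoose (fact_schur_subproof la).

Lemma fact_schurE (la : seq nat) :
  fact_schur la * vandermonde_prod = fact_schur_num la.
Proof. exact/eqP/(xchooseP (fact_schur_subproof la)). Qed.

End FactorialSchur.

(* [p]_r, in the fraction field of the ring of coefficients *)
Definition newton_coef (C : idomainType) (n : nat) (y : 'I_n -> C)
    (p : {poly C}) (r : nat) : {fraction C} :=
  \sum_(a < n | (a <= r)%N)
     tofrac p.[y a] / tofrac (\prod_(j < n | (j <= r)%N && (j != a)) (y a - y j)).

Section Demazure.

Variables (C : idomainType) (n : nat).
Implicit Types f : {mpoly C[n.+1]}.

Lemma demazure_subproof (a b : 'I_n.+1) f :
  exists q : {mpoly C[n.+1]}, q * ('X_a - 'X_b) == f - msym (tperm a b) f.
Proof.
pose P g := exists q : {mpoly C[n.+1]}, q * ('X_a - 'X_b) = g - msym (tperm a b) g.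
suff [q qE] : P f by exists q; rewrite qE.
have PM g h : P g -> P h -> P (g * h).
  move=> [q qE] [r rE]; exists (q * h + msym (tperm a b) g * r).
  rewrite mulrDl -mulrA [h * _]mulrC mulrA qE -mulrA rE msymM.
  by rewrite mulrBl mulrBr addrA subrK.
have P1 : P 1 by exists 0; rewrite mul0r msym1 subrr.
rewrite [f]mpolyE; elim/big_ind: _ => [|g h [q qE] [r rE]|m _].
- by exists 0; rewrite mul0r msym0 subrr.
- by exists (q + r); rewrite mulrDl qE rE msymD opprD addrACA.
suff [q qE] : P 'X_[m].
  by exists (f@_m *: q); rewrite -scalerAl qE msymZ scalerBr.
rewrite mpolyXE_id; elim/big_ind: _ => // c _.
elim: (m c) => [|e IHe]; first by rewrite expr0.
rewrite exprS; apply: PM => //; rewrite /P.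
have -> : msym (tperm a b) 'X_c = 'X_(tperm a b c) :> {mpoly C[n.+1]}.
  by rewrite /msym mmapX mmap1U.
case: tpermP => [->|->|_ _].
- by exists 1; rewrite mul1r.
- by exists (-1); rewrite mulN1r opprB.
- by exists 0; rewrite mul0r subrr.
Qed.

(* the operator of index j.+1, exchanging the (j+1)-st and (j+2)-nd variables *)
Definition demazure (j : nat) f : {mpoly C[n.+1]} :=
  xchoose (demazure_subproof (inord j) (inord j.+1) f).

Lemma demazureE (j : nat) f :
  demazure j f * ('X_(inord j) - 'X_(inord j.+1))
  = f - msym (tperm (inord j) (inord j.+1)) f.
Proof. exact/eqP/(xchooseP (demazure_subproof (inord j) (inord j.+1) f)). Qed.

(* r successive operators, the one exchanging the first two variables being
   applied first *)
Fixpoint demazure_chain (r : nat) f : {mpoly C[n.+1]} :=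
  if r is r'.+1 then demazure r' (demazure_chain r' f) else f.

End Demazure.

Section Specialization.

Variables (R : idomainType) (n : nat).
Local Notation A := {mpoly R[n.+1]}.

(* the equivariant parameters, as coefficients and as constants in R[y][x] *)
Definition param (j : 'I_n.+1) : A := 'X_j.
Definition paramC (k : nat) (j : 'I_n.+1) : {mpoly A[k]} := (param j)%:MP.

(* s_la(x_1, ..., x_k, x_(k+1) | y) as a polynomial in its last variable, with
   coefficients in R[y][x_1, ..., x_k] *)
Definition fact_schur_last (k : nat) (la : seq nat) : {poly {mpoly A[k]}} :=
  muni (fact_schur param k.+1 la).

Definition newton_arg (k : nat) (la : seq nat) : {poly {mpoly A[k]}} :=
  \prod_(j < k) (('X_j)%:P - 'X) * fact_schur_last k la.

(* The Demazure operators compute Newton coefficients only when they act on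
   the argument substituted for the last variable and not on the parameters of
   s_la( - | y): if both were exchanged, then for one variable and la = (1) one
   would get 0 = 1 from s_la(y_1 | y) = 0. Hence the argument is a
   fresh variable 'X_0 among 'X_0, ..., 'X_n over R[y][x]; the operators
   exchange these, and then each 'X_j is set to y_(j+1). *)
Definition demazure_arg (k : nat) (la : seq nat) : {mpoly {mpoly A[k]}[n.+1]} :=
  \prod_(j < k) (('X_j)%:MP - 'X_ord0)
  * (map_poly (@mpolyC n.+1 {mpoly A[k]}) (fact_schur_last k la)).['X_ord0].

Definition signed_image (k i : nat) (w : 'S_n.+1) : {mpoly A[k]} :=
  if psi k i w is Some w' then
    (-1) ^+ hook_height k w w' * fact_schur param k (grass_shape k w')
  else 0.

End Specialization.

(* Main.v *)
Require Import Defs.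
From HB Require Import structures.
From mathcomp Require Import all_boot all_order all_algebra.
From mathcomp Require Import fraction perm mpoly ring zify.
Set Implicit Arguments.
Unset Strict Implicit.
Unset Printing Implicit Defensive.
Import GRing.Theory.
Local Open Scope ring_scope.

(** Multiplied by the Vandermonde product of [x_1, ..., x_k], the argument of the
    Newton coefficient is the numerator determinant of the factorial Schur
    polynomial in [k.+1] variables, since the factors [x_j - x] complete the
    smaller Vandermonde product to the larger one. Only the last column of that
    determinant contains the last variable [x], and its entries are the
    factorial powers [(x|y)^(e_a)], where [e_a = w (k - a)]. Laplace expansion
    along this column ([newton_expansion]) is therefore the Newton expansion,
    because factorial powers are dual to Newton coefficients
    ([newton_coef_fact_power]). Its coefficient of index [r] is zero unless
    [r = e_a] for some [a]; it is then the signed minor without row [a], which is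
    the numerator of the factorial Schur polynomial whose exponents are those of
    [w] except [e_a].

    The rim hook procedure describes the same deletion. A column of height [k.+1]
    raises all exponents by one. Removing a rim hook with [r.+1] boxes lowers one
    exponent by [r.+1]; for the last row to become empty the lowered exponent has
    to become [0], that is, [e_a = r]. The hook then occupies the rows from [a] to
    [k], so its height is the exponent of the sign in the Laplace expansion. In
    terms of boxes this rests on [rim_hook_shifted]: connectedness and the absence
    of two by two squares force consecutive rows of the hook to overlap in exactly
    one column.

    The formula with Demazure operators follows from the first one, because a
    Demazure operator acts as the recursion step of divided differences
    ([meval_demazure_chain]). *)

(** * Newton coefficients *)

Lemma size_coef_prod_XsubC (F : comNzRingType) (I : finType) (P : pred I)
    (z : I -> F) :
  let q := \prod_(j | P j) ('X - (z j)%:P) in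
  size q = #|P|.+1 /\ q`_#|P| = 1.
Proof.
move=> q; have -> : q = \prod_(j <- enum P) ('X - (z j)%:P) by rewrite big_enum.
rewrite cardE; have sz := size_prod_XsubC (enum P) z; split; first exact: sz.
by have /monicP := monic_prod_XsubC (enum P) predT z; rewrite /lead_coef sz /=.
Qed.

(** Both sides are the coefficient of degree [#|P| - 1] of the Lagrange
    interpolation polynomial of [p], which is [p] itself. *)
Lemma lagrange_lead_coef (F : fieldType) (I : finType) (P : pred I)
    (z : I -> F) (p : {poly F}) :
  injective z -> (size p <= #|P|)%N ->
  \sum_(a | P a) p.[z a] / \prod_(j | P j && (j != a)) (z a - z j)
    = p`_#|P|.-1.
Proof.
move=> z_inj sp.
pose num a := \prod_(j | P j && (j != a)) ('X - (z j)%:P).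
pose c a := p.[z a] / \prod_(j | P j && (j != a)) (z a - z j).
pose q := \sum_(a | P a) c a *: num a.
have cardP a : P a -> #|[pred j | P j && (j != a)]| = #|P|.-1.
  move=> Pa; rewrite (cardD1 a P) [a \in P]Pa /=.
  by apply: eq_card => j; rewrite !inE andbC.
have numP a : P a -> size (num a) = #|P| /\ (num a)`_#|P|.-1 = 1.
  move=> Pa; have [] := size_coef_prod_XsubC [pred j | P j && (j != a)] z.
  rewrite cardP // => -> ->; split=> //.
  by rewrite prednK // (cardD1 a P) [a \in P]Pa.
have nz a : \prod_(j | P j && (j != a)) (z a - z j) != 0.
  apply/prodf_neq0 => j /andP[_ ja].
  by rewrite subr_eq0 (inj_eq z_inj) eq_sym.
have qz a : P a -> q.[z a] = p.[z a].
  move=> Pa; rewrite horner_sum (bigD1 a) //= big1 ?addr0 => [|b /andP[Pb ba]].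
    rewrite hornerZ /num horner_prod -[RHS](divfK (nz a)); congr (_ * _).
    by apply: eq_bigr => j _; rewrite hornerXsubC.
  rewrite hornerZ /num horner_prod (bigD1 a) /=; last by rewrite Pa eq_sym.
  by rewrite hornerXsubC subrr mul0r mulr0.
have sq : (size q <= #|P|)%N.
  apply: (leq_trans (size_sum _ _ _)); apply/bigmax_leqP => a Pa.
  by rewrite (leq_trans (size_scale_leq _ _)) // (numP a Pa).1.
have -> : p = q.
  apply/eqP; rewrite -subr_eq0; apply/eqP.
  apply: (roots_geq_poly_eq0 (rs := [seq z a | a in P])).
  - apply/allP => _ /imageP[a Pa ->].
    by rewrite /root !hornerE qz // subrr.
  - by rewrite map_inj_uniq ?enum_uniq.
  - rewrite size_image (leq_trans (size_polyD _ _)) // size_polyN geq_max.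
    by rewrite sp sq.
rewrite coef_sum; apply: eq_bigr => a Pa.
by rewrite coefZ (numP a Pa).2 mulr1 qz.
Qed.

Lemma divf_mulK (F : fieldType) (x d u : F) : u != 0 -> x / (u * d) * u = x / d.
Proof. by move=> u0; rewrite invfM mulrA mulrAC divfK. Qed.

Lemma divf_partial_fractions (F : fieldType) (x d a u v : F) :
  d != 0 -> a - v != 0 -> a - u != 0 ->
  x / ((a - v) * ((a - u) * d)) * (u - v)
    = x / ((a - u) * d) - x / ((a - v) * d).
Proof. by move=> *; field; apply/and3P; split. Qed.

Section NewtonCoefficients.

Variables (C : idomainType) (n : nat).
Implicit Types (y : 'I_n.+1 -> C) (p q : {poly C}).

Lemma newton_coef_sum y (I : finType) (f : I -> {poly C}) r :
  newton_coef y (\sum_a f a) r = \sum_a newton_coef y (f a) r.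
Proof.
rewrite /newton_coef exchange_big /=; apply: eq_bigr => a _.
by rewrite horner_sum rmorph_sum mulr_suml.
Qed.

Lemma newton_coefZ y c p r :
  newton_coef y (c *: p) r = tofrac c * newton_coef y p r.
Proof.
rewrite /newton_coef mulr_sumr; apply: eq_bigr => a _.
by rewrite hornerZ rmorphM mulrA.
Qed.

Lemma card_ord_leq r : (r <= n)%N -> #|[pred j : 'I_n.+1 | (j <= r)%N]| = r.+1.
Proof.
move=> rn; rewrite -sum1_card -[RHS]card_ord -sum1_card.
by rewrite (big_ord_widen n.+1 (fun=> 1%N)).
Qed.

(** The factorial powers are the basis dual to the Newton coefficients: for
    [r < m] each summand vanishes, otherwise the sum is a Lagrange leading
    coefficient. *)
Lemma newton_coef_fact_power y m r : injective y -> (r <= n)%N ->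
  newton_coef y (\prod_(j < n.+1 | (j < m)%N) ('X - (y j)%:P)) r
    = (r == m)%:R.
Proof.
move=> y_inj rn; have [rm|mr] := ltnP r m.
  rewrite ltn_eqF // /newton_coef big1 // => a ar.
  rewrite horner_prod (bigD1 a) /= ?(leq_ltn_trans ar) //.
  by rewrite hornerXsubC subrr mul0r rmorph0 mul0r.
pose z j := tofrac (y j).
have z_inj : injective z.
  by move=> a b /eqP; rewrite /z tofrac_eq => /eqP/y_inj.
pose p := \prod_(j < n.+1 | (j < m)%N) ('X - (z j)%:P).
have [sp cp] : size p = m.+1 /\ p`_m = 1.
  have cm : #|[pred j : 'I_n.+1 | (j < m)%N]| = m.
    case: m mr @p => [|m] mr p; last exact/card_ord_leq/ltnW/(leq_trans mr).
    by apply: eq_card0 => j; rewrite !inE.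
  by have := size_coef_prod_XsubC [pred j : 'I_n.+1 | (j < m)%N] z; rewrite cm.
have := @lagrange_lead_coef _ _ [pred j : 'I_n.+1 | (j <= r)%N] z p z_inj.
rewrite card_ord_leq // sp ltnS => /(_ mr) E.
transitivity p`_r.
  rewrite -[RHS]E /newton_coef; apply: eq_bigr => a _; congr (_ / _).
    rewrite !horner_prod rmorph_prod; apply: eq_bigr => j _.
    by rewrite !hornerXsubC rmorphB.
  by rewrite rmorph_prod; apply: eq_bigr => j _; rewrite rmorphB.
move: mr; rewrite leq_eqVlt => /predU1P[<-|mr]; first by rewrite cp eqxx.
by rewrite nth_default ?sp // gtn_eqF.
Qed.

(** The recursion of divided differences. Here [y] and [y \o tperm r r.+1] have
    the same first [r] points, and their next points are [y r] and [y r.+1]. *)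
Lemma newton_coef_tperm y p r : (r < n)%N -> injective y ->
  let t := tperm (inord r) (inord r.+1) in
  newton_coef y p r.+1 * tofrac (y (inord r) - y (inord r.+1))
    = newton_coef y p r - newton_coef (y \o t) p r.
Proof.
rename y into z; move=> rn z_inj; set u := inord r; set v := inord r.+1 => t.
have uE : u = r :> nat by rewrite inordK // ltnS ltnW.
have vE : v = r.+1 :> nat by rewrite inordK.
have uv : u != v by rewrite -val_eqE /= uE vE ltn_eqF.
have lt_u (a : 'I_n.+1) : (a <= r)%N && (a != u) = (a < r)%N.
  by rewrite -val_eqE /= uE andbC -ltn_neqAle.
have le_v (a : 'I_n.+1) : (a <= r.+1)%N && (a != v) = (a <= r)%N.
  by rewrite -val_eqE /= vE andbC -ltn_neqAle ltnS.
have tlt (a : 'I_n.+1) : (a < r)%N -> t a = a.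
  move=> ar; rewrite tpermD // -val_eqE /= ?uE ?vE gtn_eqF //.
  exact: ltnW.
have nz a b : a != b -> tofrac (z a - z b) != 0.
  by rewrite tofrac_eq0 subr_eq0 (inj_eq z_inj).
have nzP a (Q : pred 'I_n.+1) : ~~ Q a -> tofrac (\prod_(j | Q j) (z a - z j)) != 0.
  move=> Qa; rewrite rmorph_prod; apply/prodf_neq0 => j Qj; apply: nz.
  by apply: contra Qa => /eqP ->.
pose D a := tofrac (\prod_(j < n.+1 | (j < r)%N && (j != a)) (z a - z j)).
have Dnz a : D a != 0 by apply: nzP; rewrite eqxx andbF.
have den_u : \prod_(j < n.+1 | (j <= r)%N && (j != u)) (z u - z j)
           = \prod_(j < n.+1 | (j < r)%N && (j != u)) (z u - z j).
  apply: eq_bigl => j; rewrite lt_u; case: ltnP => // jr.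
  by rewrite -val_eqE /= uE ltn_eqF.
have den_v : \prod_(j < n.+1 | (j <= r)%N && (j != u)) (z v - z (t j))
           = \prod_(j < n.+1 | (j < r)%N && (j != v)) (z v - z j).
  apply: eq_big => [j|j]; rewrite lt_u.
    case: ltnP => // jr; by rewrite -val_eqE /= vE ltn_eqF // ltnW.
  by move=> jr; rewrite tlt.
have den_lt (a : 'I_n.+1) : (a < r)%N ->
  tofrac (\prod_(j < n.+1 | (j <= r)%N && (j != a)) (z a - z j))
    = tofrac (z a - z u) * D a.
  move=> ar; rewrite -rmorphM (bigD1 u) /=; last first.
    by rewrite uE leqnn -val_eqE /= uE gtn_eqF.
  congr (tofrac (_ * _)); apply: eq_bigl => j.
  by rewrite andbAC lt_u.
have den_lt' (a : 'I_n.+1) : (a < r)%N ->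
  tofrac (\prod_(j < n.+1 | (j <= r)%N && (j != a)) (z a - z (t j)))
    = tofrac (z a - z v) * D a.
  move=> ar; rewrite -rmorphM (bigD1 u) /=; last first.
    by rewrite uE leqnn -val_eqE /= uE gtn_eqF.
  rewrite tpermL; congr (tofrac (_ * _)); apply: eq_big => [j|j].
    by rewrite andbAC lt_u.
  by rewrite andbAC lt_u => /andP[jr _]; rewrite tlt.
have den_S a : a != v ->
  tofrac (\prod_(j < n.+1 | (j <= r.+1)%N && (j != a)) (z a - z j))
    = tofrac (z a - z v)
      * tofrac (\prod_(j < n.+1 | (j <= r)%N && (j != a)) (z a - z j)).
  move=> av; rewrite -rmorphM (bigD1 v) /=; last by rewrite vE leqnn eq_sym av.
  by congr (tofrac (_ * _)); apply: eq_bigl => j; rewrite andbAC le_v.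
have den_vS : tofrac (\prod_(j < n.+1 | (j <= r.+1)%N && (j != v)) (z v - z j))
    = tofrac (z v - z u) * D v.
  rewrite -rmorphM (bigD1 u) /=; last by rewrite uE leqnSn uv.
  congr (tofrac (_ * _)); apply: eq_bigl => j.
  by rewrite le_v lt_u; case: ltnP => // jr; rewrite -val_eqE /= vE ltn_eqF // ltnW.
have sum_r (G : 'I_n.+1 -> {fraction C}) :
    \sum_(a < n.+1 | (a <= r)%N) G a = G u + \sum_(a < n.+1 | (a < r)%N) G a.
  by rewrite (bigD1 u) ?uE //=; congr (_ + _); apply: eq_bigl.
have sum_rS (G : 'I_n.+1 -> {fraction C}) :
    \sum_(a < n.+1 | (a <= r.+1)%N) G a
      = G v + (G u + \sum_(a < n.+1 | (a < r)%N) G a).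
  by rewrite -sum_r (bigD1 v) ?vE //=; congr (_ + _); apply: eq_bigl.
rewrite /newton_coef sum_rS !sum_r /= tpermL.
rewrite den_u den_v den_vS (den_S u) // den_u -/(D u) -/(D v).
rewrite opprD addrACA -sumrB !mulrDl addrA; congr (_ + _).
  rewrite addrC; congr (_ + _).
    exact: divf_mulK (nz _ _ uv).
  by rewrite -[z u - z v]opprB rmorphN mulrN divf_mulK // nz // eq_sym.
rewrite mulr_suml; apply: eq_bigr => a ar.
have au : a != u by rewrite -val_eqE /= uE ltn_eqF.
have av : a != v by rewrite -val_eqE /= vE ltn_eqF // ltnW.
rewrite /= tlt // den_S // den_lt // den_lt' //.
have := nz _ _ au; have := nz _ _ av; rewrite !rmorphB /=.
by move=> av0 au0; rewrite divf_partial_fractions ?Dnz.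
Qed.

End NewtonCoefficients.
(** * Demazure operators as divided differences *)

Lemma meval_msym (R : comNzRingType) n (s : 'S_n) (p : {mpoly R[n]})
    (z : 'I_n -> R) :
  (msym s p).@[z] = p.@[z \o s].
Proof.
rewrite [p]mpolyE (raddf_sum (msym s)) !(raddf_sum (meval _)) /=; apply: eq_bigr => m _.
rewrite msymZ !mevalZ; congr (_ * _).
rewrite /msym mmapX /mmap1 rmorph_prod mevalX; apply: eq_bigr => i _.
by rewrite rmorphXn /= mevalXU.
Qed.

Lemma mapC_polyXsubC (C : comNzRingType) n (c : C) (t : {mpoly C[n]}) :
  (map_poly (@mpolyC n C) (c%:P - 'X)).[t] = c%:MP - t.
Proof. by rewrite rmorphB /= map_polyC map_polyX !hornerE. Qed.

(** Evaluating the defining equation of a Demazure operator gives the recursion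
    of divided differences; since the operator permutes the variables, the
    induction must range over all tuples [z] of distinct points. *)
Lemma meval_demazure_chain (C : idomainType) n (P : {poly C}) r
    (z : 'I_n.+1 -> C) :
  (r <= n)%N -> injective z ->
  tofrac (demazure_chain r (map_poly (@mpolyC n.+1 C) P).['X_ord0]).@[z]
    = newton_coef z P r.
Proof.
elim: r z => [|r IHr] z rn z_inj /=.
  rewrite /newton_coef (bigD1 ord0) //= big1 => [|a]; last first.
    by rewrite -val_eqE /= leqn0 => /andP[->].
  rewrite big1 => [|j]; last by rewrite -val_eqE /= leqn0 => /andP[->].
  rewrite rmorph1 divr1 addr0; congr tofrac.
  elim/poly_ind: P => [|P c IHP]; first by rewrite map_poly0 !horner0 meval0.
  rewrite rmorphD rmorphM /= map_polyX map_polyC !hornerE.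
  by rewrite mevalD mevalM IHP mevalC mevalXU.
set f := _.['X_ord0] in IHr *.
have nz : tofrac (z (inord r) - z (inord r.+1)) != 0.
  rewrite tofrac_eq0 subr_eq0 (inj_eq z_inj) -val_eqE /= !inordK ?ltnS //.
    by rewrite ltn_eqF.
  exact: ltnW.
have zt_inj := inj_comp z_inj (@perm_inj _ (tperm (inord r) (inord r.+1))).
apply: (mulIf nz); rewrite newton_coef_tperm // -!IHr ?(ltnW rn) //.
rewrite -tofracM -tofracB; congr tofrac.
have /(congr1 (meval z)) := demazureE r (demazure_chain r f).
by rewrite mevalM !mevalB !mevalXU meval_msym.
Qed.

(** * Laplace expansion in the last variable *)

Lemma muni_widen (R : nzRingType) k (i : 'I_k) :
  muni ('X_(widen_ord (leqnSn k) i) : {mpoly R[k.+1]}) = ('X_i)%:P.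
Proof.
rewrite muniE msuppX big_seq1 mcoeffX eqxx scale1r mnm1E eqE /= ltn_eqF //.
rewrite expr0 alg_polyC; congr ('X_[_])%:P; apply/mnmP => j.
by rewrite mnmE !mnm1E.
Qed.

Lemma muni_max (R : nzRingType) k :
  muni ('X_ord_max : {mpoly R[k.+1]}) = 'X.
Proof.
rewrite muniE msuppX big_seq1 mcoeffX eqxx scale1r mnm1E eqxx expr1.
have -> : [multinom U_(ord_max)%MM (widen_ord (leqnSn k) i) | i < k] = 0%MM.
  by apply/mnmP => i; rewrite mnmE mnm1E mnm0E eqE /= gtn_eqF.
by rewrite mpolyX0 scale1r.
Qed.

Lemma muni_vandermonde (A : idomainType) k :
  muni (vandermonde_prod A k.+1)
    = (vandermonde_prod A k)%:P * \prod_(j < k) (('X_j)%:P - 'X).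
Proof.
rewrite /vandermonde_prod big_ord_recr /= [X in _ * X]big1 ?mulr1; last first.
  by move=> b; rewrite ltnNge -ltnS ltn_ord.
rewrite !rmorph_prod -big_split; apply: eq_bigr => a _ /=.
rewrite !rmorph_prod [LHS]big_mkcond big_ord_recr /= ltn_ord; congr (_ * _).
  rewrite [RHS]big_mkcond; apply: eq_bigr => b _ /=.
  by case: ifP => // _; rewrite !rmorphB /= !muni_widen.
by rewrite rmorphB /= muni_widen muni_max.
Qed.

(** Multiplied by the Vandermonde product of the first [k] variables, the left
    side becomes the image of the numerator of the factorial Schur polynomial;
    its last column is the only one that involves the last variable. *)
Lemma newton_expansion (A : idomainType) n (y : 'I_n -> A) k (la : seq nat) :
  let e a := (nth 0 la a + k.+1 - a.+1)%N in
  let yC j := (y j)%:MP_[k] in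
  vandermonde_prod A k *:
      (\prod_(j < k) (('X_j)%:P - 'X) * muni (fact_schur y k.+1 la))
    = \sum_(a < k.+1) ((-1) ^+ (a + k)
        * \det (\matrix_(c < k, b < k) fact_power yC 'X_b (e (lift a c))))
      *: \prod_(j < n | (j < e a)%N) ('X - (yC j)%:P).
Proof.
move=> e yC; rewrite -mul_polyC mulrA -muni_vandermonde mulrC -muniM fact_schurE.
rewrite /fact_schur_num -det_map_mx (expand_det_col _ ord_max).
apply: eq_bigr => a _; rewrite !mxE mulrC -mul_polyC; congr (_ * _).
  rewrite /cofactor polyCM rmorphXn rmorphN1 -det_map_mx; congr (_ * \det _).
  apply/matrixP => c b; rewrite !mxE /fact_power !rmorph_prod.
  apply: eq_bigr => j _; rewrite !rmorphB /= muniC; congr (_ - _).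
  rewrite -muni_widen; congr (muni 'X_ _); apply: val_inj.
  by rewrite /= /bump leqNgt ltn_ord.
rewrite /fact_power rmorph_prod; apply: eq_bigr => j _.
by rewrite rmorphB /= muniC muni_max.
Qed.

(** * Rim hooks that meet the last row *)

Lemma adjacentC m n (c d : 'I_m * 'I_n) : adjacent c d = adjacent d c.
Proof.
rewrite /adjacent [c.1 == _]eq_sym [c.2 == _]eq_sym.
by congr (_ && _ || _ && _); apply: orbC.
Qed.

Section RimHookLastRow.

Variables (k N : nat) (nu mu : seq nat).
Local Notation cell := ('I_k.+1 * 'I_N)%type.
Local Notation H := (diagram k.+1 N nu :\: diagram k.+1 N mu).
Local Open Scope nat_scope.
Local Notation "s .[ c ]" := (nth 0 s c) : nat_scope.

(** The skew shape is a rim hook from row [a] down to row [k]: the equation says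
    that the hook has exactly one column in common in rows [c] and [c.+1]. *)
Definition shifted_from a :=
  (forall c, c < a -> mu.[c] = nu.[c])
  /\ (forall c, a <= c < k -> nu.[c.+1] = mu.[c].+1).

Hypothesis nu_dec : forall c, nu.[c.+1] <= nu.[c].
Hypothesis mu_dec : forall c, mu.[c.+1] <= mu.[c].
Hypothesis nu0N : nu.[0] <= N.
Hypothesis mu0N : mu.[0] <= N.
Hypothesis nuk_gt0 : 0 < nu.[k].
Hypothesis muk : mu.[k] = 0.

Let nuN c : nu.[c] <= N.
Proof. by elim: c => // c; apply: leq_trans. Qed.

Let muN c : mu.[c] <= N.
Proof. by elim: c => // c; apply: leq_trans. Qed.

Lemma mem_skew (c : cell) : (c \in H) = (mu.[c.1] <= c.2 < nu.[c.1]).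
Proof. by rewrite !inE -leqNgt. Qed.

Lemma card_skew : #|H| = \sum_(0 <= c < k.+1) (nu.[c] - mu.[c]).
Proof.
rewrite -sum1_card (eq_bigl _ _ mem_skew).
rewrite -(pair_big_dep xpredT (fun (c : 'I_k.+1) (b : 'I_N) =>
   (mu.[c] <= b < nu.[c])) (fun _ _ => 1)) /= big_mkord.
apply: eq_bigr => c _.
rewrite -(big_mkord (fun b => (mu.[c] <= b < nu.[c])) (fun=> 1)).
rewrite -[RHS]muln1 -sum_nat_const_nat [RHS](big_nat_widen _ _ N) //.
rewrite [RHS](big_nat_widenl _ 0) //; apply: eq_bigl => b.
by rewrite andbC.
Qed.

Section Shifted.

Variable a : nat.
Hypotheses (ak : a <= k) (sh : shifted_from a).

Lemma mu_lt_nu c : a <= c <= k -> mu.[c] < nu.[c].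
Proof.
move=> /andP[ac]; rewrite leq_eqVlt => /predU1P[->|ck]; first by rewrite muk.
by rewrite -(sh.2 c) ?ac // nu_dec.
Qed.

Lemma card_shifted : #|H| = nu.[a] + (k - a).
Proof.
rewrite card_skew (big_cat_nat (n := a)) ?(leq_trans ak) //=.
rewrite big_nat big1 => [|c /andP[_ ca]]; last by rewrite sh.1 // subnn.
rewrite add0n; have [d dE] : exists d, d = k - a by exists (k - a).
have : forall c, a <= c < k -> nu.[c.+1] = mu.[c].+1 := sh.2.
elim: d a ak dE => [|d IHd] b bk dE shb.
  by have -> : b = k; [lia | rewrite big_nat1 muk; lia].
rewrite big_ltn ?ltnS // IHd; [|lia|lia|by move=> c ?; apply: shb; lia].
have := shb b; have := nu_dec b; lia.
Qed.

Lemma shifted_sub : diagram k.+1 N mu \subset diagram k.+1 N nu.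
Proof.
apply/subsetP => -[c b]; rewrite !inE /=; have [ca|ac] := ltnP c a.
  by rewrite sh.1.
move/leq_trans; apply; apply/ltnW/mu_lt_nu.
by rewrite ac -ltnS ltn_ord.
Qed.

Lemma shifted_no_square : ~~ has_2x2_square H.
Proof.
apply/existsP => -[c /existsP[c' /existsP[b /existsP[b']]]].
rewrite !mem_skew /= => /and5P[/eqP cc /eqP bb + _ /andP[_ /andP[_]]].
rewrite bb cc => /andP[h1 h2].
have [ca|ac] := ltnP c a; first by rewrite sh.1 in h1 => //; lia.
have ck : c < k by rewrite -ltnS -cc ltn_ord.
by rewrite (sh.2 c) ?ac //; lia.
Qed.

(** From every box of the hook one reaches the box in the last row and the first
    column, moving left inside a row and down at its first box. *)
Lemma shifted_connected : connected_cells H.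
Proof.
set e := [rel c d : cell | [&& c \in H, d \in H & adjacent c d]].
have e_sym : connect_sym e.
  by apply: sym_connect_sym => c d /=; rewrite adjacentC andbCA.
have N0 : 0 < N by apply: leq_trans nuk_gt0 (nuN k).
pose z : cell := (ord_max, Ordinal N0).
suff toz c : c \in H -> connect e c z.
  apply/forall_inP => c cH; apply/forall_inP => d dH.
  by apply: connect_trans (toz c cH) _; rewrite e_sym toz.
have [m] := ubnP (k - c.1 + c.2); elim: m c => // m IHm [c b] /= lem cH.
have := cH; rewrite mem_skew /= => /andP[mub bnu].
have ac : a <= c by case: leqP => // ca; move: mub bnu; rewrite sh.1 //; lia.
have ck : c <= k by rewrite -ltnS ltn_ord.
have step (d : cell) : d \in H -> adjacent (c, b) d ->
    k - d.1 + d.2 < k - c + b -> connect e (c, b) z.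
  move=> dH adj ltd; apply: (connect_trans (y := d)).
    by apply: connect1; rewrite /= cH dH adj.
  by apply: IHm => //; apply: leq_trans ltd lem.
have [mub'|] := ltnP mu.[c] b.
  have b'N : b.-1 < N by have := ltn_ord b; lia.
  apply: (step (c, Ordinal b'N)); rewrite ?mem_skew /= ?/adjacent /=; last lia.
    lia.
  by rewrite eqxx; apply/orP; left; apply/orP; right; apply/eqP => /=; lia.
move=> bmu; have {mub bmu} bE : b = mu.[c] :> nat by lia.
move: ck; rewrite leq_eqVlt => /predU1P[ck|ck].
  suff -> : (c, b) = z by apply: connect0.
  by congr (_, _); apply: val_inj; rewrite //= bE ck muk.
have c'k : c.+1 < k.+1 by [].
apply: (step (Ordinal c'k, b)); rewrite ?mem_skew /= ?/adjacent /=; last lia.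
  by rewrite (sh.2 c) ?ac // bE mu_dec leqnn.
by rewrite eqxx; apply/orP; right; apply/orP; left; apply/eqP.
Qed.

Lemma shifted_rim_hook : rim_hook_removal k.+1 N (nu.[a] + (k - a)) nu mu.
Proof.
by apply/and4P; split;
   [apply: shifted_sub | rewrite card_shifted | apply: shifted_connected
   | apply: shifted_no_square].
Qed.

Lemma leg_length_shifted : leg_length k.+1 N nu mu = k - a.
Proof.
have -> : leg_length k.+1 N nu mu = #|[set c : 'I_k.+1 | a <= c]|.-1.
  congr (#|(_ : {set _})|.-1); apply/setP => c; rewrite inE.
  apply/imsetP/idP => [[d dH ->]|ac].
    case: leqP => // da; move: dH; rewrite mem_skew sh.1 //; lia.
  have ck : c <= k by rewrite -ltnS ltn_ord.
  have lt := mu_lt_nu (c := c); rewrite ac ck in lt.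
  have bN : mu.[c] < N := leq_trans (lt isT) (nuN c).
  by exists (c, Ordinal bN) => //; rewrite mem_skew /= leqnn lt.
rewrite cardsE -sum1_card -(big_mkord (fun c => a <= c) (fun=> 1)).
rewrite (_ : \sum_(_ <= _ < _ | _) _ = \sum_(a <= c < k.+1) 1).
  by rewrite sum_nat_const_nat muln1 subSn.
by rewrite [RHS](big_nat_widenl _ 0).
Qed.

End Shifted.

(** As the hook is connected and reaches the last row, any two consecutive rows
    from its first row downwards share a column; as it contains no two by two
    square, they share only one. *)
Lemma rim_hook_shifted l : rim_hook_removal k.+1 N l nu mu ->
  exists a, [/\ a <= k, shifted_from a & l = nu.[a] + (k - a)].
Proof.
case/and4P => sub /eqP cardH conn no_sq.
have le_mu c : c <= k -> mu.[c] <= nu.[c].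
  move=> ck; rewrite leqNgt; apply/negP => lt.
  have bN : nu.[c] < N := leq_trans lt (muN c).
  have := subsetP sub (Ordinal (ck : c < k.+1), Ordinal bN).
  by rewrite !inE /= lt ltnn => /(_ isT).
have exa : exists c, mu.[c] < nu.[c] by exists k; rewrite muk.
case: (ex_minnP exa) => a lta mina.
have ak : a <= k by apply: mina; rewrite muk.
suff sh : shifted_from a by exists a; split; rewrite // -cardH (card_shifted ak).
split=> c => [ca|/andP[ac ck]].
  apply/eqP; rewrite eqn_leq le_mu ?(leq_trans (ltnW ca)) //=.
  by rewrite leqNgt; apply/negP => /mina; rewrite leqNgt ca.
apply/eqP; rewrite eqn_leq; apply/andP; split; rewrite leqNgt; apply/negP => lt.
  have b'N : mu.[c].+1 < N by apply: leq_trans lt (nuN _).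
  case/negP: no_sq; apply/existsP; exists (Ordinal (ltnW ck : c < k.+1)).
  apply/existsP; exists (Ordinal (ck : c.+1 < k.+1)).
  apply/existsP; exists (Ordinal (ltnW b'N)).
  apply/existsP; exists (Ordinal b'N); rewrite !mem_skew /= !eqxx /=.
  by have := mu_dec c; have := nu_dec c; lia.
have aN : mu.[a] < N := leq_trans lta (nuN a).
have zN : 0 < N by apply: leq_trans nuk_gt0 (nuN k).
pose s : cell := (Ordinal (ak : a < k.+1), Ordinal aN).
pose z : cell := (ord_max, Ordinal zN).
have sH : s \in H by rewrite mem_skew /= leqnn.
have zH : z \in H by rewrite mem_skew /= muk nuk_gt0.
have := forall_inP (forall_inP conn s sH) z zH.
(* A path from row [a] to row [k] would have to step from row [c] to [c.+1]. *)
set e := (X in connect X) => s_to_z.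
have crossing d d' : e d d' -> d.1 <= c -> d'.1 <= c.
  rewrite /e /= !mem_skew /adjacent => /and3P[/andP[mud _] /andP[_ d'nu] adj] dc.
  case/orP: adj => /andP[/eqP col]; first by rewrite -col.
  case/orP=> /eqP row; last by rewrite -row in dc; apply: ltnW.
  rewrite leqNgt; apply/negP => cd.
  have dE : d.1 = c :> nat by apply/eqP; rewrite eqn_leq dc -ltnS row.
  rewrite dE col in mud; rewrite -row dE in d'nu.
  by have := leq_ltn_trans mud d'nu; rewrite ltnNge -ltnS lt.
have crossing' d d' : e d d' -> d'.1 <= c -> d.1 <= c.
  move=> edd'; apply: crossing; move: edd'; rewrite /e /=.
  by rewrite (adjacentC d) andbCA.
have cl : closed e [pred d : cell | d.1 <= c].
  by move=> d d' edd'; apply/idP/idP; [apply: crossing | apply: crossing'].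
have := closed_connect cl s_to_z.
by rewrite !inE /= ac leqNgt ck.
Qed.

End RimHookLastRow.

(** * Shapes of Grassmannian permutations *)

Section GrassmannianShapes.

Variables (n k : nat) (w : 'S_n.+1).
Hypotheses (kn : (k <= n.+1)%N) (gw : grassmannian k w).

Lemma grassmannian_lt i j : (i < j < k)%N -> (w (inord i) < w (inord j))%N.
Proof.
move=> /andP[ij jk]; have jn := leq_trans jk kn.
apply: (implyP (forallP (forallP gw (inord i)) (inord j))).
by rewrite !inordK ?ij ?jk //; apply: ltn_trans ij jn.
Qed.

Lemma grassmannian_ge j : (j < k)%N -> (j <= w (inord j))%N.
Proof.
elim: j => // j IHj jk; apply: leq_ltn_trans (IHj (ltnW jk)) _.
by apply: grassmannian_lt; rewrite ltnSn.
Qed.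

Lemma grass_shape_default c : (k <= c)%N -> nth 0%N (grass_shape k w) c = 0%N.
Proof. by move=> kc; rewrite nth_default // size_map size_iota. Qed.

(** No truncation occurs in the shape: strictly increasing values satisfy
    [j <= w j]. *)
Lemma grass_shapeD c : (c < k)%N ->
  (nth 0 (grass_shape k w) c + k)%N = (w (inord (k - c.+1)) + c.+1)%N.
Proof.
move=> ck; rewrite (nth_map 0%N) ?size_iota // nth_iota // add0n.
have := @grassmannian_ge (k - c.+1); lia.
Qed.

Lemma grass_exponent c : (c < k)%N ->
  (nth 0 (grass_shape k w) c + k - c.+1)%N = w (inord (k - c.+1)).
Proof. by move=> ck; rewrite grass_shapeD // addnK. Qed.

Lemma grass_shape_dec c :
  (nth 0 (grass_shape k w) c.+1 <= nth 0 (grass_shape k w) c)%N.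
Proof.
have [ck|kc] := ltnP c.+1 k; last by rewrite grass_shape_default.
have := grass_shapeD ck; have := grass_shapeD (ltnW ck).
have := @grassmannian_lt (k - c.+2) (k - c.+1); lia.
Qed.

Lemma grass_shape0_le : (nth 0 (grass_shape k w) 0 + k <= n.+1)%N.
Proof.
have [k0|k0] := posnP k; first by rewrite grass_shape_default k0.
by rewrite grass_shapeD // addn1 ltn_ord.
Qed.

Lemma nth_add_column c :
  nth 0%N (add_column (grass_shape k w)) c
    = if (c < k)%N then (nth 0 (grass_shape k w) c).+1 else 0%N.
Proof.
case: ltnP => ck; first by rewrite (nth_map 0%N) // size_map size_iota.
by rewrite nth_default // !size_map size_iota.
Qed.

End GrassmannianShapes.

(** The remaining values are listed in increasing order. *)
Lemma grassmannian_exists n k (b : 'I_k -> 'I_n.+1) :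
  (forall i j : 'I_k, (i < j)%N -> (b i < b j)%N) ->
  exists2 w : 'S_n.+1, grassmannian k w & forall j : 'I_k, w (inord j) = b j.
Proof.
move=> b_lt.
have b_inj : injective b.
  move=> i j bij; case: (ltngtP i j) => [/b_lt|/b_lt|/val_inj //].
    by rewrite bij ltnn.
  by rewrite bij ltnn.
have kn : (k <= n.+1)%N.
  by have := leq_card b b_inj; rewrite !card_ord.
pose L := codom b ++ enum [predC codom b].
have sL : size L = n.+1.
  rewrite size_cat size_codom -(card_codom b_inj) -cardE.
  by rewrite cardC card_ord.
have uL : uniq L.
  rewrite cat_uniq map_inj_uniq // !enum_uniq andbT /=.
  by apply/hasPn => x; rewrite mem_enum.
have f_inj : injective (fun x : 'I_n.+1 => nth ord0 L x).
  move=> x y /eqP; rewrite nth_uniq ?sL ?ltn_ord // => /eqP; exact: val_inj.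
have wlt (x : 'I_n.+1) (xk : (x < k)%N) : perm f_inj x = b (Ordinal xk).
  rewrite permE nth_cat size_codom card_ord xk.
  rewrite (nth_map (Ordinal xk)) ?size_enum_ord //; congr b.
  exact: (nth_ord_enum (Ordinal xk) (Ordinal xk)).
exists (perm f_inj) => [|j]; last first.
  have jn : (j < n.+1)%N by apply: leq_trans (ltn_ord j) kn.
  have jk : ((inord j : 'I_n.+1) < k)%N by rewrite inordK.
  by rewrite wlt; congr b; apply: val_inj; rewrite /= inordK.
apply/forallP => x; apply/forallP => y; apply/implyP => /andP[xy].
case/orP => [yk|kx].
  by rewrite (wlt x (ltn_trans xy yk)) (wlt y yk); apply: b_lt.
have ky := leq_trans kx (ltnW xy).
rewrite !permE !nth_cat size_codom card_ord ifN -?leqNgt // ifN -?leqNgt //.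
have tr : transitive (fun u v : 'I_n.+1 => (u < v)%N).
  by move=> u v t; apply: ltn_trans.
have srt : sorted (fun u v : 'I_n.+1 => (u < v)%N) (enum [predC codom b]).
  apply: sorted_filter => //.
  by rewrite -enumT -(sorted_map (f := val) (e' := ltn)) val_enum_ord iota_ltn_sorted.
have sz : size (enum [predC codom b]) = (n.+1 - k)%N.
  by move: sL; rewrite size_cat size_codom card_ord => /(canRL (addKn k)).
apply: (sorted_ltn_nth tr _ srt); rewrite ?inE ?sz.
- exact: ltn_sub2r (leq_ltn_trans kx (ltn_ord x)) (ltn_ord x).
- exact: ltn_sub2r (leq_ltn_trans kx (ltn_ord x)) (ltn_ord y).
- exact: ltn_sub2r (leq_ltn_trans kx xy) xy.
Qed.

(** * Adding a column and removing a rim hook *)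

Section PsiCriterion.

Variables (n k : nat) (w w' : 'S_n.+1).
Hypotheses (kn : (k <= n)%N) (gw : grassmannian k.+1 w) (gw' : grassmannian k w').
Let nu := add_column (grass_shape k.+1 w).
Let mu := grass_shape k w'.

Let knS : (k <= n.+1)%N. Proof. exact: leqW. Qed.

(** As [w (k - a)] is the exponent of row [a] in the numerator determinant, this
    is the deletion of row [a], written in terms of permutations. *)
Definition omits_value a :=
  forall c, (c < k)%N -> w' (inord (k - c.+1)) = w (inord (k - bump a c)).

Let nuE c : (c <= k)%N -> (nth 0 nu c + k = w (inord (k - c)) + c.+1)%N.
Proof.
move=> ck; rewrite nth_add_column ltnS ck.
by rewrite addSnnS grass_shapeD ?subSS.
Qed.

Let muE c : (c < k)%N -> (nth 0 mu c + k = w' (inord (k - c.+1)) + c.+1)%N.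
Proof. exact: grass_shapeD. Qed.

(** Row [c] of [nu] has [w (k - c)] as exponent, up to a shift by [c] that differs
    by one between [nu] and [mu]; the shifts turn the equations between rows into
    equations between exponents. *)
Lemma shifted_omits a : (a <= k)%N -> shifted_from k nu mu a <-> omits_value a.
Proof.
move=> ak; split=> [[mu_lt mu_ge] c ck|om].
  apply: val_inj => /=; have := muE ck; have [ca|ac] := ltnP c a.
    by rewrite mu_lt // nuE ?(ltnW ck) // /bump leqNgt ca add0n; lia.
  have := mu_ge c; rewrite ac ck => /(_ isT); have := nuE (ck : (c.+1 <= k)%N).
  by rewrite /bump ac add1n; lia.
split=> c => [ca|/andP[ac ck]].
  have ck := leq_trans ca ak.
  have := muE ck; have := nuE (ltnW ck); rewrite om // /bump leqNgt ca add0n.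
  lia.
have := muE ck; have := nuE ck; rewrite om // /bump ac add1n; lia.
Qed.

Let nu_dec c : (nth 0 nu c.+1 <= nth 0 nu c)%N.
Proof.
rewrite !nth_add_column; case: ltnP => // ck.
by rewrite (ltnW ck) ltnS grass_shape_dec.
Qed.

Let mu_dec c : (nth 0 mu c.+1 <= nth 0 mu c)%N.
Proof. exact: grass_shape_dec. Qed.

Let nu0N : (nth 0 nu 0 <= n.+1)%N.
Proof.
have := grass_shape0_le (kn : (k.+1 <= n.+1)%N) gw; apply: leq_trans.
by rewrite nth_add_column /= addnS ltnS leq_addr.
Qed.

Let mu0N : (nth 0 mu 0 <= n.+1)%N.
Proof. by apply: leq_trans (grass_shape0_le knS gw'); apply: leq_addr. Qed.

Let nuk_gt0 : (0 < nth 0 nu k)%N.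
Proof. by rewrite nth_add_column ltnSn. Qed.

Let muk : nth 0%N mu k = 0%N.
Proof. exact: grass_shape_default. Qed.

Let hook_size a : (a <= k)%N -> (nth 0 nu a + (k - a) = (w (inord (k - a))).+1)%N.
Proof. by move=> ak; have := nuE ak; lia. Qed.

Lemma rim_hook_omits l : rim_hook_removal k.+1 n.+1 l nu mu ->
  exists a, [/\ (a <= k)%N, omits_value a & l = (w (inord (k - a))).+1].
Proof.
case/(rim_hook_shifted nu_dec mu_dec nu0N mu0N nuk_gt0 muk) => a [ak sh ->].
by exists a; rewrite hook_size //; split=> //; apply/shifted_omits.
Qed.

Lemma omits_rim_hook a : (a <= k)%N -> omits_value a ->
  rim_hook_removal k.+1 n.+1 (w (inord (k - a))).+1 nu mu.
Proof.
move=> ak /(shifted_omits ak) sh; rewrite -hook_size //.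
exact: shifted_rim_hook.
Qed.

Lemma hook_height_omits a : (a <= k)%N -> omits_value a ->
  hook_height k w w' = (k - a)%N.
Proof. by move=> ak /(shifted_omits ak) sh; apply: leg_length_shifted. Qed.

End PsiCriterion.

Lemma omits_value_exists n k (w : 'S_n.+1) a :
  (k <= n)%N -> grassmannian k.+1 w -> (a <= k)%N ->
  exists2 w' : 'S_n.+1, grassmannian k w' & omits_value k w w' a.
Proof.
move=> kn gw ak.
have b_lt (i j : 'I_k) : (i < j)%N ->
    (w (inord (bump (k - a) i)) < w (inord (bump (k - a) j)))%N.
  move=> ij; apply: (grassmannian_lt (kn : (k.+1 <= n.+1)%N) gw).
  by have := ltn_ord j; rewrite /bump; lia.
have [w' gw' w'E] := grassmannian_exists b_lt.
exists w' => // c ck; have ck' : (k - c.+1 < k)%N by lia.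
rewrite (w'E (Ordinal ck')) /=; congr (w (inord _)).
by rewrite /bump; lia.
Qed.

(** * The theorem *)

Lemma vandermonde_neq0 (A : idomainType) k : vandermonde_prod A k != 0.
Proof.
apply/prodf_neq0 => a _; apply/prodf_neq0 => b ab.
apply/eqP => /(congr1 (mcoeff U_(a))).
rewrite mcoeffB !mcoeffXU eqxx -val_eqE /= gtn_eqF // subr0 mcoeff0.
by move/eqP; rewrite oner_eq0.
Qed.

Lemma paramC_inj (R : idomainType) n k : injective (paramC R (n := n) k).
Proof.
move=> i j /eqP; rewrite mpolyC_eq => /eqP /(congr1 (mcoeff U_(i))).
rewrite !mcoeffXU eqxx; case: eqVneq => // _ /eqP.
by rewrite oner_eq0.
Qed.

Lemma demazure_argE (R : idomainType) n k la :
  demazure_arg R n k la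
    = (map_poly (@mpolyC n.+1 _) (newton_arg R n k la)).['X_ord0].
Proof.
rewrite /demazure_arg /newton_arg rmorphM hornerM; congr (_ * _).
rewrite rmorph_prod horner_prod; apply: eq_bigr => j _.
by rewrite mapC_polyXsubC.
Qed.

(** Both sides are compared after multiplication by the Vandermonde product, where
    the left one is a sum of signed minors and the right one is the numerator of
    the factorial Schur polynomial of the image under [psi]. *)
Lemma newton_coef_signed_image (R : idomainType) (n k r : nat) (w : 'S_n.+1) :
  (k <= n)%N -> (r <= n)%N -> grassmannian k.+1 w ->
  newton_coef (paramC R (n := n) k) (newton_arg R n k (grass_shape k.+1 w)) r
    = tofrac (signed_image R k r.+1 w).
Proof.
move=> kn rn gw; set la := grass_shape k.+1 w.
have V0 : tofrac (vandermonde_prod {mpoly R[n.+1]} k) != 0.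
  by rewrite tofrac_eq0 vandermonde_neq0.
apply: (mulfI V0); rewrite -newton_coefZ newton_expansion newton_coef_sum.
under eq_bigr => a _.
  rewrite newton_coefZ newton_coef_fact_power //; last exact: paramC_inj.
  rewrite grass_exponent ?ltn_ord // subSS.
  over.
rewrite -tofracM /signed_image /psi.
case: pickP => [w' /andP[gw' rh]|none]; last first.
  rewrite mulr0 tofrac0 big1 // => a _; have ak : (a <= k)%N by rewrite -ltnS.
  case: eqP => [rE|_]; last by rewrite mulr0.
  have [w' gw' om] := omits_value_exists kn gw ak.
  by have := none w'; rewrite gw' rE omits_rim_hook.
have [a [ak om [rE]]] := rim_hook_omits kn gw gw' rh.
rewrite (hook_height_omits kn gw gw' ak om).
(* The two exponents differ by [2 * a]. *)
have signE : (-1) ^+ (a + k) = (-1) ^+ (k - a) :> {mpoly {mpoly R[n.+1]}[k]}.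
  rewrite -signr_odd -[RHS]signr_odd oddB // oddD addbC.
  by case: (odd a); case: (odd k).
rewrite (bigD1 (Ordinal (ak : (a < k.+1)%N))) //= big1 => [|b ba]; last first.
  rewrite rE; case: eqP => [/val_inj/perm_inj/(congr1 val)|_]; last by rewrite mulr0.
  rewrite /= !inordK; try lia.
  move=> E; case/eqP: ba; apply: val_inj => /=.
  by have := ltn_ord b; lia.
rewrite rE eqxx mulr1 addr0 mulrCA [_ * fact_schur _ _ _]mulrC fact_schurE.
rewrite signE; apply: (congr1 (fun d => tofrac (_ * d))).
rewrite /fact_schur_num; congr (\det _).
apply/matrixP => c b; rewrite !mxE; congr fact_power => /=.
rewrite (grass_exponent (leqW kn) gw') // om //.
have ltb := ltn_ord (lift (Ordinal (ak : (a < k.+1)%N)) c).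
by rewrite (grass_exponent (kn : (k.+1 <= n.+1)%N) gw ltb) subSS.
Qed.

(* The numbers n and k of the mathematical statement are n.+1 and k.+1 here. *)
Theorem proposition3p13 (R : idomainType) (n k i : nat) (w : 'S_n.+1)
    (hn : (2 <= n.+1)%N) (hk : (1 <= k.+1 <= n.+1)%N) (hi : (1 <= i <= n.+1)%N)
    (hw : grassmannian k.+1 w) :
  newton_coef (paramC R (n := n) k) (newton_arg R n k (grass_shape k.+1 w)) i.-1
    = tofrac (signed_image R k i w)
  /\
  (demazure_chain i.-1 (demazure_arg R n k (grass_shape k.+1 w))).@[paramC R (n := n) k]
    = signed_image R k i w.
Proof.
case: i hi => [/andP[]//|r /andP[_ rn]].
have main := newton_coef_signed_image R (hk : (k <= n)%N) rn hw.
split=> //; apply/eqP; rewrite -tofrac_eq -main demazure_argE; apply/eqP.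
by apply: meval_demazure_chain => //; apply: paramC_inj.
Qed.
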